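(* Let $K\in\mathbb N$, let $P_1,\dots,P_K$ be p*-variables (with arbitrary dependence), and let $w_1,\dots,w_K$ be random variables with $w_1,\dots,w_K\ge0$, $\sum_{k=1}^Kw_k=1$, and $(w_1,\dots,w_K)$ independent of $(P_1,\dots,P_K)$. Let $\tilde P=\prod_{k=1}^KP_k^{w_k}$. Then $\mathrm e\,\tilde P$ is a p-variable, where $\mathrm e=\exp(1)$. That is, $$\mathbb P\left(\prod_{k=1}^KP_k^{w_k}\le\alpha\right)\le \mathrm e\,\alpha\quad\text{for all }\alpha\in(0,1).$$
   Context: For random variables $X,Y$: $X\le_1 Y$ means $\mathbb E[f(X)]\le \mathbb E[f(Y)]$ for all increasing real functions $f$ such that the expectations exist; $X\le_2 Y$ means the same inequality for all increasing concave real functions $f$ such that the expectations exist (''increasing'' is non-strict). With $U$ uniform on $[0,1]$: $P$ is a p-variable if $U\le_1 P$ (equivalently $\mathbb P(P\le\alpha)\le\alpha$ for all $\alpha\in(0,1)$); $P$ is a p*-variable if $U\le_2 P$. Here $\prod_{k=1}^K P_k^{w_k}=\exp(\sum_{k=1}^K w_k\log P_k)$ (p*-variables are almost surely positive). The weights $w_1,\dots,w_K$ may be arbitrarily dependent among themselves. *)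

(* Defs.v *)
From HB Require Import structures.
From mathcomp Require Import all_boot all_order all_algebra.
From mathcomp Require Import all_classical all_reals all_analysis.
From mathcomp Require Import measurable_realfun.

Set Implicit Arguments.
Unset Strict Implicit.
Unset Printing Implicit Defensive.

Import Order.TTheory GRing.Theory Num.Theory.
Import numFieldNormedType.Exports.

Local Open Scope classical_set_scope.
Local Open Scope ring_scope.

(* "Increasing" is non-strict. *)
Definition increasing (R : realType) (f : R -> R) : Prop :=
  {homo f : x y / x <= y}.

Definition concave (R : realType) (f : R -> R) : Prop :=
  convex_function [set: R^o] (fun x => - f x).

Section expectation_exists.
Context (R : realType) (d : measure_display) (T : measurableType d)
  (P : probability T R).

(* The expectation of f(X) exists as an extended real, possibly infinite:
   its positive and negative parts are not both of infinite expectation. *)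
Definition expectation_exists (f : R -> R) (X : {RV P >-> R}) : Prop :=
  ('E_P[(fun t => Num.max (f (X t)) 0)%R] < +oo)%E \/
  ('E_P[(fun t => Num.max (- f (X t)) 0)%R] < +oo)%E.

End expectation_exists.
Arguments expectation_exists {R d T} P f X.

Section stochastic_orders.
Context (R : realType) (d d' : measure_display) (T : measurableType d)
  (T' : measurableType d') (P : probability T R) (P' : probability T' R).

(* The two random variables may live on different probability spaces, since
   both orders depend only on the distributions. *)
Definition sto_le1 (X : {RV P >-> R}) (Y : {RV P' >-> R}) : Prop :=
  forall f : R -> R, increasing f ->
    expectation_exists P f X -> expectation_exists P' f Y ->
    ('E_P[f \o X] <= 'E_P'[f \o Y])%E.

Definition sto_le2 (X : {RV P >-> R}) (Y : {RV P' >-> R}) : Prop :=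
  forall f : R -> R, increasing f -> concave f ->
    expectation_exists P f X -> expectation_exists P' f Y ->
    ('E_P[f \o X] <= 'E_P'[f \o Y])%E.

End stochastic_orders.
Arguments sto_le1 {R d d' T T'} P P' X Y.
Arguments sto_le2 {R d d' T T'} P P' X Y.

(* A uniform random variable on [0, 1], realized as the identity of the
   probability space (R, uniform distribution on [0, 1]). *)
Definition uniform01 (R : realType) : probability (measurableTypeR R) R :=
  uniform_prob (@ltr01 R).

Definition idR (R : realType) : measurableTypeR R -> R := idfun.

HB.instance Definition _ (R : realType) :=
  @isMeasurableFun.Build _ _ _ _ (@idR R) (@measurable_id _ _ setT).

Definition U01 (R : realType) : {RV (uniform01 R) >-> R} := @idR R.

Section pvariables.
Context (R : realType) (d : measure_display) (T : measurableType d)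
  (P : probability T R).

Definition p_variable (X : {RV P >-> R}) : Prop :=
  sto_le1 (uniform01 R) P (U01 R) X.

Definition pstar_variable (X : {RV P >-> R}) : Prop :=
  sto_le2 (uniform01 R) P (U01 R) X.

Definition independent_RV (d1 d2 : measure_display)
    (T1 : measurableType d1) (T2 : measurableType d2)
    (X : {RV P >-> T1}) (Y : {RV P >-> T2}) : Prop :=
  forall (A : set T1) (B : set T2), measurable A -> measurable B ->
    P (X @^-1` A `&` Y @^-1` B) = (P (X @^-1` A) * P (Y @^-1` B))%E.

End pvariables.
Arguments p_variable {R d T} P X.
Arguments pstar_variable {R d T} P X.
Arguments independent_RV {R d T} P {d1 d2 T1 T2} X Y.

Section families.
Context (R : realType) (d : measure_display) (T : measurableType d) (K : nat).

Definition joint (X : 'I_K -> {mfun T >-> R}) (t : T) : K.-tuple R :=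
  [tuple X k t | k < K].

Lemma measurable_joint (X : 'I_K -> {mfun T >-> R}) :
  measurable_fun setT (joint X).
Proof.
apply/measurable_fun_tnthP => k.
rewrite (_ : _ \o _ = X k); first exact: measurable_funPT.
by apply/funext => t; rewrite /= tnth_mktuple.
Qed.

HB.instance Definition _ (X : 'I_K -> {mfun T >-> R}) :=
  isMeasurableFun.Build _ _ _ _ (joint X) (measurable_joint X).

(* prod_k X_k ^ w_k; its value is immaterial on the event where some X_k is
   nonpositive, which is null for p*-variables. *)
Definition wgeom_mean (w X : 'I_K -> {mfun T >-> R}) (t : T) : R :=
  expR (\sum_(k < K) w k t * ln (X k t)).

Lemma measurable_wgeom_mean (w X : 'I_K -> {mfun T >-> R}) :
  measurable_fun setT (wgeom_mean w X).
Proof.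
apply: measurableT_comp => //; apply: measurable_sum => k.
by apply: measurable_funM => //; apply: measurableT_comp.
Qed.

HB.instance Definition _ (w X : 'I_K -> {mfun T >-> R}) :=
  isMeasurableFun.Build _ _ _ _ (wgeom_mean w X) (measurable_wgeom_mean w X).

End families.

(* Main.v *)
Require Import Defs.
From HB Require Import structures.
From mathcomp Require Import all_boot all_order all_algebra.
From mathcomp Require Import all_classical all_reals all_analysis.
From mathcomp Require Import measurable_realfun.
From mathcomp Require Import ring lra.

Set Implicit Arguments.
Unset Strict Implicit.
Unset Printing Implicit Defensive.

Import Order.TTheory GRing.Theory Num.Theory.
Import numFieldNormedType.Exports.

Local Open Scope classical_set_scope.
Local Open Scope ring_scope.

(* Since 1_{y <= ln a} <= (ln (e a) - y)^+ and this bound is convex in y, on the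
   event \prod_k P_k^{w_k} <= a one has 1 <= \sum_k w_k (ln (e a / P_k))^+.
   The function p |-> - (ln (e a / p))^+ is increasing and concave, so
   E[(ln (e a / P_k))^+] <= E[(ln (e a / U))^+] <= e a, the last step because
   (ln (e a / U))^+ exceeds y with probability at most e a exp(- y). By
   independence the w_k contribute only their expectations, which sum to 1.
   The logarithm is replaced by its tangent below a small level, at the cost of
   an error that vanishes with this level. *)

(** * Tail comparison of expectations, and the uniform law *)

(** Layer-cake formula: a nonnegative function has as expectation the integral over [[0, +oo[] of
    its tail probabilities, so functions on different probability spaces can be compared. *)
Lemma ge0_expectation_le (R : realType) (d d' : measure_display)
    (T : measurableType d) (T' : measurableType d')
    (P : probability T R) (P' : probability T' R) (f : T -> R) (g : T' -> R) :
  measurable_fun setT f -> measurable_fun setT g ->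
  (forall x, 0 <= f x) -> (forall x, 0 <= g x) ->
  (forall y, 0 <= y ->
    (P [set x | y < f x]%R <= P' [set x | y < g x]%R)%E) ->
  ('E_P[f] <= 'E_P'[g])%E.
Proof.
move=> mf mg f0 g0 fg.
pose F : {RV P >-> R} := mfun_Sub (mem_set mf).
pose G : {RV P' >-> R} := mfun_Sub (mem_set mg).
have ccdfE d1 (S : measurableType d1) (Q : probability S R)
    (Z : {RV Q >-> R}) y : ccdf Z y = Q [set x | y < Z x]%R.
  by congr (Q _); apply/seteqP; split => x /=; rewrite in_itv/= andbT.
rewrite -[f]/(F : _ -> _) -[g]/(G : _ -> _) !ge0_expectation_ccdf//.
apply: ge0_le_integral => //=.
- by apply: measurable_funTS; exact: ccdf_measurable.
- by apply: measurable_funTS; exact: ccdf_measurable.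
- by move=> y; rewrite in_itv/= andbT !ccdfE => y0; exact: fg.
Qed.

Lemma uniform01E (R : realType) (A : set R) : measurable A ->
  uniform01 R A = lebesgue_measure (A `&` `[0, 1]).
Proof.
move=> mA; rewrite [LHS](@integral_uniform_pdf R 0 1 A).
have mA01 : measurable (A `&` `[0, 1]) by exact: measurableI.
rewrite -[RHS]mul1e -[RHS]integral_cst//.
apply: eq_integral => x; rewrite inE/= in_itv/= => -[_ x01].
by rewrite /uniform_pdf x01 subr0 invr1.
Qed.

Lemma uniform01_lt (R : realType) (a : R) :
  uniform01 R [set x | x < a]%R = (Num.max 0 (Num.min a 1))%:E.
Proof.
have mA : measurable ([set x | x < a]%R : set R).
  by rewrite -set_itvNyo; exact: measurable_itv.
rewrite uniform01E//.
have [a1|a1] := leP a 1.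
  rewrite (_ : _ `&` _ = `[0, a[%classic); last first.
    apply/seteqP; split=> x /=; rewrite !in_itv/=; first by case=> -> /andP[->].
    by case/andP => -> xa; split => //=; rewrite (ltW (lt_le_trans xa a1)).
  rewrite lebesgue_measure_itv/= lte_fin; case: ltP => a0.
    by rewrite sube0.
  by [].
rewrite (_ : _ `&` _ = `[0, 1]%classic); last first.
  apply/seteqP; split=> x /=; first by case.
  by rewrite in_itv/= => /andP[-> x1]; split => //; exact: le_lt_trans a1.
by rewrite lebesgue_measure_itv/= lte_fin ltr01 sube0 max_r.
Qed.


(** * From a bound on the distribution function to a p-variable *)

(** A down-set is empty, the whole line, or lies between the open and the closed half-line ending at
    its supremum. These two half-lines have the same uniform measure, as that law has no atoms. *)
Lemma down_set_measure_le (R : realType) (d : measure_display)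
    (T : measurableType d) (P : probability T R) (Y : {RV P >-> R})
    (D : set R) :
  (forall a, 0 < a < 1 -> (P [set t | (Y t <= a)%R] <= a%:E)%E) ->
  measurable D -> (forall x y, x <= y -> D y -> D x) ->
  (P (Y @^-1` D) <= uniform01 R D)%E.
Proof.
move=> Ya mD downD.
have mYD : measurable (Y @^-1` D) by exact: measurable_funPTI.
have mYle a : measurable [set t | Y t <= a]%R.
  rewrite (_ : [set _ | _] = Y @^-1` `]-oo, a]); first exact: measurable_funPTI.
  by apply/seteqP; split => x /=; rewrite in_itv.
have cdfY a : (P [set t | (Y t <= a)%R] <= (Num.max 0 (Num.min a 1))%:E)%E.
  have [a0|a0] := leP a 0.
    rewrite max_l; last by rewrite ge_min a0.
    (* For [a <= 0] the event lies in the one at any level [e] of []0, 1[]; let [e] tend to 0. *)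
    apply/lee_addgt0Pr => e e0; rewrite add0e.
    have [e1|e1] := ltP e 1; last first.
      by rewrite (le_trans (probability_le1 _ _))// lee_fin.
    apply: le_trans (Ya _ _); last by rewrite e0.
    rewrite le_measure ?inE// => t /= /le_trans; apply.
    by rewrite (le_trans a0)// ltW.
  have [a1|a1] := ltP a 1.
    by rewrite max_r ?(ltW a0)// Ya// a0.
  by rewrite max_r// probability_le1.
have [->|D0] := eqVneq D set0; first by rewrite preimage_set0 !measure0.
have [[b Db]|nubD] := pselect (has_ubound D); last first.
  rewrite (_ : D = setT) ?preimage_setT ?probability_setT//.
  apply/seteqP; split => // x _; apply: contrapT => nDx; apply: nubD.
  exists x => y Dy; rewrite leNgt; apply/negP => xy; apply: nDx.
  exact: downD (ltW xy) Dy.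
have supD : has_sup D by split; [exact/set0P|exists b].
apply: (@le_trans _ _ (P [set t | (Y t <= sup D)%R])).
  rewrite le_measure ?inE// => t /= DYt.
  exact: (ub_le_sup (proj2 supD)).
rewrite (le_trans (cdfY _))// -uniform01_lt le_measure ?inE//.
  by rewrite -set_itvNyo; exact: measurable_itv.
move=> x /= xs.
have [y Dy xy] := @sup_gt R D x (proj1 supD) xs.
exact: downD (ltW xy) Dy.
Qed.

(** For increasing [f], the superlevel sets of the positive part are complements of down-sets and
    those of the negative part are down-sets. Hence [Y] has the larger positive part and the smaller
    negative part in expectation. *)
Lemma p_variable_cdf (R : realType) (d : measure_display)
    (T : measurableType d) (P : probability T R) (Y : {RV P >-> R}) :
  (forall a, 0 < a < 1 -> (P [set t | (Y t <= a)%R] <= a%:E)%E) ->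
  p_variable P Y.
Proof.
move=> Ya f f_nd _ _.
have mf : measurable_fun setT f by exact: nondecreasing_measurable.
have mD (D : set R) : (forall x y, x <= y -> D y -> D x) -> measurable D.
  move=> downD; apply: is_interval_measurable => x y Dx Dy z /andP[_ zy].
  exact: downD zy Dy.
have mU : measurable_fun setT (@U01 R : R -> R) by exact: measurable_id.
have expE d1 (S : measurableType d1) (Q : probability S R) (Z : S -> R) :
    ('E_Q[f \o Z] = 'E_Q[(fun x => Num.max (f (Z x)) 0)%R] -
                    'E_Q[(fun x => Num.max (- f (Z x)) 0)%R])%E.
  rewrite unlock integralE; congr (_ - _)%E; apply: eq_integral => x _.
    by rewrite funeposE/= EFin_max.
  by rewrite funenegE/= EFin_max.
have mfp : measurable_fun setT (fun x => Num.max (f x) 0).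
  exact: measurable_maxr.
have mfn : measurable_fun setT (fun x => Num.max (- f x) 0).
  by apply: measurable_maxr => //; exact: measurableT_comp.
rewrite !expE; apply: leeB.
- apply: ge0_expectation_le.
  + exact: (measurableT_comp mfp mU).
  + exact: (measurableT_comp mfp).
  + by move=> x; rewrite le_max lexx orbT.
  + by move=> x; rewrite le_max lexx orbT.
  + move=> y y0; pose D := [set x | Num.max (f x) 0 <= y].
    have downD x z : x <= z -> D z -> D x.
      rewrite /D /= !ge_max => xz /andP[fz ->]; rewrite andbT.
      exact: le_trans (f_nd _ _ xz) fz.
    have /(_ D) := down_set_measure_le Ya.
    move=> /(_ (mD _ downD) downD) DYU.
    have mYD : measurable (Y @^-1` D).
      by apply: measurable_funPTI; exact: mD.
    rewrite (_ : [set x | _] = ~` D); last first.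
      by apply/seteqP; split => x /=; rewrite /D /= ltNge => /negP.
    rewrite (_ : [set x | _] = ~` (Y @^-1` D)); last first.
      by apply/seteqP; split => x /=; rewrite /D /= ltNge => /negP.
    rewrite !probability_setC//; last exact: mD.
    by rewrite leeB.
- apply: ge0_expectation_le.
  + exact: (measurableT_comp mfn).
  + exact: (measurableT_comp mfn mU).
  + by move=> x; rewrite le_max lexx orbT.
  + by move=> x; rewrite le_max lexx orbT.
  + move=> y y0; pose D := [set x | y < Num.max (- f x) 0].
    have downD x z : x <= z -> D z -> D x.
      rewrite /D /= => xz /lt_le_trans; apply.
      rewrite ge_max !le_max lexx orbT andbT lerN2.
      by rewrite f_nd.
    exact: (down_set_measure_le Ya (mD _ downD) downD).
Qed.

(** * Concavity and the truncated logarithmic test *)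

(** Average the supporting line at the convex combination [z] over the two endpoints: the slope
    terms cancel. *)
Lemma supporting_lines_concave (R : realType) (f : R -> R) :
  (forall z, exists m, forall p, f p <= f z + m * (p - z)) -> concave f.
Proof.
move=> supp t x y _ _; rewrite convRE.
have -> : conv t x y = t%:num * x + unstable.onem t%:num * y :> R.
  exact: convRE.
set s := t%:num; set z := _ * x + _.
have [m fm] := supp z.
have s0 : 0 <= s by rewrite /s.
have s1 : 0 <= 1 - s by rewrite subr_ge0 /s.
have := ler_wpM2l s0 (fm x); have := ler_wpM2l s1 (fm y).
rewrite /unstable.onem -/s !mulrDr => fy fx.
have : s * (m * (x - z)) + (1 - s) * (m * (y - z)) = 0.
  by rewrite /z /unstable.onem; ring.
have -> : s * - f x + (1 - s) * - f y = - (s * f x + (1 - s) * f y) by ring.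
have : s * f z + (1 - s) * f z = f z by ring.
lra.
Qed.

Section log_test.
Context (R : realType).
Implicit Types c e p : R.

(* The logarithm, continued linearly by its tangent to the left of [e]: the
   stochastic order only tests functions that are real-valued on all of [R]. *)
Definition tangent_ln e p : R := ln (Num.max p e) + (p - Num.max p e) / e.

(** For [c > 0] and [e > 0], this is the positive part of [ln (c / p)] when [p >= e]. *)
Definition log_test c e p : R := Num.max 0 (ln c - tangent_ln e p).

Lemma log_test_ge0 c e p : 0 <= log_test c e p.
Proof. by rewrite le_max lexx. Qed.

Lemma tangent_ln_ge e p : e <= p -> tangent_ln e p = ln p.
Proof. by move=> ep; rewrite /tangent_ln max_l// subrr mul0r addr0. Qed.

Lemma ln_leB1 (x : R) : 0 < x -> ln x <= x - 1.
Proof.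
by move=> x0; rewrite -{1}(subrKC 1 x) le_ln1Dx// ltrBDr addrC subrr.
Qed.

Lemma ln_le_tangent_ln e p : 0 < e -> 0 < p -> ln p <= tangent_ln e p.
Proof.
move=> e0 p0; have [ep|pe] := leP e p; first by rewrite tangent_ln_ge.
rewrite /tangent_ln max_r ?(ltW pe)// mulrBl divff ?gt_eqF//.
by have := ln_leB1 (divr_gt0 p0 e0); rewrite ln_div ?posrE//; lra.
Qed.

Lemma tangent_ln_le e z p : 0 < e ->
  tangent_ln e p <= tangent_ln e z + (Num.max z e)^-1 * (p - z).
Proof.
move=> e0; rewrite /tangent_ln; set a := Num.max p e; set b := Num.max z e.
have a0 : 0 < a by rewrite lt_max e0 orbT.
have b0 : 0 < b by rewrite lt_max e0 orbT.
have := ln_leB1 (divr_gt0 a0 b0); rewrite ln_div ?posrE// => lnab.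
(* What remains once [ln (a / b)] is bounded by [a / b - 1]. For [z >= e] the factors have opposite
   signs; for [z < e] the second one vanishes. *)
suff : (a - p - (b - z)) * (b^-1 - e^-1) <= 0.
  move=> h; have bb : b / b = 1 by rewrite divff// gt_eqF.
  nra.
have [ez|ze] := leP e z.
  rewrite /b max_l// subrr subr0 mulr_ge0_le0 ?subr_ge0 ?subr_le0//.
    by rewrite le_max lexx.
  by rewrite lef_pV2 ?posrE// (lt_le_trans e0).
by rewrite /b max_r ?(ltW ze)// subrr mulr0.
Qed.

Lemma tangent_ln_nd e : 0 < e -> {homo tangent_ln e : p q / p <= q}.
Proof.
move=> e0 p q pq; have := tangent_ln_le q p e0.
move/le_trans; apply; rewrite gerDl mulr_ge0_le0 ?subr_le0//.
by rewrite invr_ge0 le_max (ltW e0) orbT.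
Qed.

Lemma log_test_opp_nd c e : 0 < e -> increasing (fun p => - log_test c e p).
Proof.
move=> e0 p q pq; rewrite lerN2 /log_test ge_max !le_max lexx /=.
by rewrite lerB ?tangent_ln_nd ?orbT.
Qed.

(** A supporting slope at [z] is 0 where the test vanishes, and that of [tangent_ln e] elsewhere. *)
Lemma log_test_opp_concave c e : 0 < e -> concave (fun p => - log_test c e p).
Proof.
move=> e0; apply: supporting_lines_concave => z.
have [h|h] := leP (ln c - tangent_ln e z) 0.
  exists 0 => p; rewrite mul0r addr0 lerN2.
  by rewrite {1}/log_test max_l ?log_test_ge0.
exists (Num.max z e)^-1 => p.
rewrite {2}/log_test max_r ?(ltW h)// lerNl opprD opprK le_max.
by apply/orP; right; have := tangent_ln_le z p e0; lra.
Qed.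

Lemma measurable_log_test c e : 0 < e -> measurable_fun setT (log_test c e).
Proof.
move=> e0; rewrite (_ : log_test c e = fun p => - - log_test c e p); last first.
  by apply/funext => p; rewrite opprK.
apply: measurableT_comp => //; apply: nondecreasing_measurable => //.
exact: log_test_opp_nd.
Qed.

(** The constant [expR 1 * e] makes the test at least [ln (expR 1 * e) - ln e = 1] on the whole
    region [p <= e], nonpositive values included. *)
Lemma log_test_small e p : 0 < e -> p <= e -> 1 <= log_test (expR 1 * e) e p.
Proof.
move=> e0 pe; rewrite le_max; apply/orP; right.
rewrite lnM ?posrE ?expR_gt0// expRK /tangent_ln max_r//.
have : (p - e) / e <= 0.
  by rewrite mulr_le0_ge0 ?subr_le0// invr_ge0 ltW.
lra.
Qed.

Lemma expectation_log_test_U01 c e : 0 < c -> 0 < e ->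
  ('E_(uniform01 R)[log_test c e \o U01 R] <= c%:E)%E.
Proof.
move=> c0 e0.
have mg : measurable_fun setT (log_test c e \o U01 R).
  exact: (measurableT_comp (measurable_log_test c e0) (@measurable_id _ _ setT)).
pose G : {RV (uniform01 R) >-> R} := mfun_Sub (mem_set mg).
rewrite -[_ \o _]/(G : _ -> _) ge0_expectation_ccdf; last first.
  by move=> x; exact: log_test_ge0.
(* The tail at [y] is at most [c * expR (- y)], which is [c] times the exponential density of rate
   1, of total mass 1. *)
apply: (@le_trans _ _ (\int[lebesgue_measure]_(y in `[0%R, +oo[)
  (c%:E * (exponential_pdf 1 y)%:E))%E).
  apply: ge0_le_integral => //.
  - by apply: measurable_funTS; exact: ccdf_measurable.
  - apply/measurable_EFinP; apply: measurable_funTS; apply: measurable_funM => //.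
    exact: measurable_exponential_pdf.
  - move=> y /=; rewrite in_itv/= andbT => y0.
    rewrite exponential_pdfE// mul1r mulN1r.
    set b := c * expR (- y).
    have b0 : 0 < b by rewrite mulr_gt0 ?expR_gt0.
    rewrite -EFinM -/b.
    apply: (@le_trans _ _ (uniform01 R [set x | x < b]%R)); last first.
      by rewrite uniform01_lt lee_fin ge_max (ltW b0) ge_min lexx.
    apply: (@le_measure _ _ _ (uniform01 R) (G @^-1` `]y, +oo[)); rewrite ?inE.
    + exact: measurable_funPTI.
    + by rewrite -set_itvNyo; exact: measurable_itv.
    (* Contrapositive: if [b <= x], then [tangent_ln e x >= ln x >= ln b = ln c - y], so the test
       does not exceed [y]. *)
    + move=> x /=; rewrite in_itv/= andbT lt_max ltNge y0/=.
      rewrite ltNge => yx; rewrite ltNge; apply: contra yx => bx.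
      have x0 := lt_le_trans b0 bx.
      have lnx := ln_le_tangent_ln e0 x0.
      have : ln b <= ln x by rewrite ler_ln ?posrE.
      rewrite lnM ?posrE ?expR_gt0// expRK.
      by rewrite /U01 /idR /= in lnx *; lra.
rewrite ge0_integralZl//; last 3 first.
- by apply/measurable_EFinP; apply: measurable_funTS; exact: measurable_exponential_pdf.
- by move=> y _; rewrite lee_fin exponential_pdf_ge0.
- by rewrite lee_fin ltW.
rewrite -[leRHS]mule1 lee_pmul2l ?lte_fin//.
rewrite -(@integral_exponential_pdf R 1)//; apply: ge0_subset_integral => //.
- by apply/measurable_EFinP; exact: measurable_exponential_pdf.
- by move=> y _; rewrite lee_fin exponential_pdf_ge0.
Qed.

End log_test.

Lemma pstar_expectation_log_test (R : realType) (d : measure_display)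
    (T : measurableType d) (P : probability T R) (X : {RV P >-> R}) (c e : R) :
  pstar_variable P X -> 0 < c -> 0 < e ->
  ('E_P[log_test c e \o X] <= c%:E)%E.
Proof.
move=> Xp c0 e0.
have exists_exp d1 (S : measurableType d1) (Q : probability S R)
    (Z : {RV Q >-> R}) : expectation_exists Q (fun p => - log_test c e p) Z.
  (* The function tested is nonpositive, so its positive part is 0. *)
  left; rewrite (_ : (fun _ => _) = cst 0); last first.
    by apply/funext => t /=; rewrite max_r// oppr_le0 log_test_ge0.
  by rewrite expectation_cst ltry.
have expN d1 (S : measurableType d1) (Q : probability S R) (Z : S -> R) :
    ('E_Q[(fun p => (- log_test c e p)%R) \o Z] = - 'E_Q[log_test c e \o Z])%E.
  rewrite unlock -integral_ge0N//= => x _.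
  by rewrite lee_fin log_test_ge0.
have := Xp _ (@log_test_opp_nd R c e e0) (@log_test_opp_concave R c e e0)
  (exists_exp _ _ _ _) (exists_exp _ _ _ _).
rewrite !expN leeN2 => /le_trans; apply.
exact: expectation_log_test_U01.
Qed.

(** * Expectation of a product of independent nonnegative factors *)

Lemma independent_expectationM (R : realType) (d d1 d2 : measure_display)
    (T : measurableType d) (T1 : measurableType d1) (T2 : measurableType d2)
    (P : probability T R) (X : {RV P >-> T1}) (Y : {RV P >-> T2})
    (f : T1 -> R) (g : T2 -> R) :
  independent_RV P X Y ->
  measurable_fun setT f -> measurable_fun setT g ->
  (forall x, 0 <= f x) -> (forall y, 0 <= g y) ->
  ('E_P[(f \o X) \* (g \o Y)] = 'E_P[f \o X] * 'E_P[g \o Y])%E.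
Proof.
move=> XY mf mg f0 g0.
have mXY : measurable_fun setT (fun t => (X t, Y t)).
  exact: measurable_fun_pair.
pose XY' : {RV P >-> (T1 * T2)%type} := mfun_Sub (mem_set mXY).
pose h (z : T1 * T2) : \bar R := (f z.1 * g z.2)%:E.
have mh : measurable_fun setT h.
  apply/measurable_EFinP; apply: measurable_funM.
    exact: (measurableT_comp mf measurable_fst).
  exact: (measurableT_comp mg measurable_snd).
have h0 z : (0 <= h z)%E by rewrite lee_fin mulr_ge0.
have -> : ('E_P[(f \o X) \* (g \o Y)] = \int[distribution P XY']_z h z)%E.
  by rewrite ge0_integral_distribution// unlock.
have -> : (\int[distribution P XY']_z h z =
    \int[distribution P X \x distribution P Y]_z h z)%E.
  (* Independence says that the joint law agrees with the product measure on rectangles, which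
     determines it. *)
  apply: eq_measure_integral => A mA _; apply/esym.
  exact: product_measure_unique.
rewrite fubini_tonelli1//=.
rewrite [LHS](_ : _ = \int[distribution P X]_x
    ((f x)%:E * 'E_P[g \o Y])%E)%E; last first.
  apply: eq_integral => x _; rewrite /fubini_F /h/=.
  under eq_integral do rewrite EFinM.
  rewrite ge0_integralZl//; last 3 first.
  - exact/measurable_EFinP.
  - by move=> y _; rewrite lee_fin.
  - by rewrite lee_fin.
  congr (_ * _)%E.
  rewrite ge0_integral_distribution//; last exact/measurable_EFinP.
  by rewrite unlock.
rewrite ge0_integralZr//; last 3 first.
- exact/measurable_EFinP.
- by move=> y _; rewrite lee_fin.
- by apply: expectation_ge0 => y /=.
congr (_ * _)%E.
rewrite ge0_integral_distribution//; last exact/measurable_EFinP.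
by rewrite unlock.
Qed.

(** * The tail bound for the weighted geometric mean *)

Section geometric_mean.
Context (R : realType) (d : measure_display) (T : measurableType d)
  (P : probability T R) (K : nat) (X w : 'I_K -> {RV P >-> R}).
Hypotheses (X_pstar : forall k, pstar_variable P (X k))
  (w_ge0 : forall k, {ae P, forall t, 0 <= w k t})
  (w_sum1 : {ae P, forall t, \sum_(k < K) w k t = 1})
  (wX_indep : independent_RV P (joint w) (joint X)).

(** The weights are nonnegative only almost surely; their positive parts are so everywhere, as the
    integration lemmas for nonnegative functions require. *)
Let wpos k t : R := Num.max 0 (w k t).

Let measurable_wpos k : measurable_fun setT (wpos k).
Proof. exact: measurable_maxr. Qed.

Let wpos_ge0 k t : 0 <= wpos k t.
Proof. by rewrite le_max lexx. Qed.

Let ae_wposE : {ae P, forall t, forall k, wpos k t = w k t}.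
Proof.
apply: filterS (filter_forall _ w_ge0) => t w0 k.
by rewrite /wpos max_r.
Qed.

Lemma sum_expectation_weights : (\sum_(k < K) 'E_P[wpos k] = 1)%E.
Proof.
transitivity (\int[P]_t (\sum_(k < K) wpos k t)%:E)%E.
  under [RHS]eq_integral do rewrite -sumEFin.
  rewrite ge0_integral_sum//.
  - by apply: eq_bigr => k _; rewrite unlock.
  - by move=> k; exact/measurable_EFinP.
  - by move=> k t _; rewrite lee_fin.
rewrite -[RHS](@probability_setT _ _ _ P) -[RHS]mul1e -[RHS]integral_cst//.
apply: ge0_ae_eq_integral => //.
- by apply/measurable_EFinP; exact: measurable_sum.
- by move=> t _; rewrite lee_fin sumr_ge0.
- apply: filterS2 ae_wposE w_sum1 => t wE w1 _ /=.
  by rewrite -w1; congr (_%:E); apply: eq_bigr.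
Qed.

Lemma expectation_weighted_log_test (c e : R) k : 0 < c -> 0 < e ->
  ('E_P[wpos k \* (log_test c e \o X k)] <= 'E_P[wpos k] * c%:E)%E.
Proof.
move=> c0 e0.
(* Independence is between the whole vectors, so each factor is written as a function of one
   tuple. *)
have -> : wpos k \* (log_test c e \o X k) =
    ((fun u : K.-tuple R => Num.max 0 (tnth u k)) \o joint w) \*
    ((fun u : K.-tuple R => log_test c e (tnth u k)) \o joint X).
  by apply/funext => t; rewrite /= /wpos !tnth_mktuple.
rewrite independent_expectationM//.
- have -> : (fun u : K.-tuple R => Num.max 0 (tnth u k)) \o joint w = wpos k.
    by apply/funext => t; rewrite /= /wpos tnth_mktuple.
  have -> : (fun u : K.-tuple R => log_test c e (tnth u k)) \o joint X =
      log_test c e \o X k.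
    by apply/funext => t; rewrite /= tnth_mktuple.
  apply: lee_wpmul2l; first exact: expectation_ge0.
  exact: pstar_expectation_log_test.
- by apply: measurable_maxr => //; exact: measurable_tnth.
- by apply: (measurableT_comp (measurable_log_test c e0)); exact: measurable_tnth.
- by move=> u; rewrite le_max lexx.
- by move=> u; exact: log_test_ge0.
Qed.

(* Either some [X k] is at most [e] and the second sum exceeds 1, or every
   [tangent_ln] is a true logarithm and the first sum is at least
   [ln (expR 1 * a) - ln a = 1]. *)
Lemma wgeom_mean_le_log_test (a e : R) (t : T) : 0 < a -> 0 < e ->
  (forall k, wpos k t = w k t) -> \sum_(k < K) w k t = 1 ->
  wgeom_mean w X t <= a ->
  1 <= \sum_(k < K) wpos k t * log_test (expR 1 * a) e (X k t) +
       \sum_(k < K) log_test (expR 1 * e) e (X k t).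
Proof.
move=> a0 e0 wE w1 Wa.
have g0 c k : 0 <= log_test c e (X k t) by exact: log_test_ge0.
have [[k Xk]|/forallNP eX] := pselect (exists k, X k t <= e).
  rewrite -[leLHS]add0r lerD//.
    by apply: sumr_ge0 => i _; rewrite mulr_ge0.
  rewrite (bigD1 k)//= -[leLHS]addr0 lerD ?sumr_ge0//.
  exact: log_test_small.
rewrite -[leLHS]addr0 lerD ?sumr_ge0//.
have lnW : \sum_(k < K) w k t * ln (X k t) <= ln a.
  by rewrite -ler_expR lnK ?posrE.
apply: (@le_trans _ _ (\sum_(k < K) w k t * (1 + ln a - ln (X k t)))).
  under eq_bigr do rewrite mulrBr.
  by rewrite sumrB -mulr_suml w1; lra.
apply: ler_sum => k _; rewrite -wE ler_wpM2l//.
rewrite le_max lnM ?posrE ?expR_gt0// expRK tangent_ln_ge ?lexx ?orbT//.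
by rewrite leNgt; apply/negP => /ltW /eX.
Qed.

Lemma wgeom_mean_prob_le (a : R) : 0 < a ->
  (P [set t | (wgeom_mean w X t <= a)%R] <= (expR 1 * a)%:E)%E.
Proof.
move=> a0; apply/lee_addgt0Pr => delta delta0.
(* The [K] tests for small values cost at most [expR 1 * e] each, hence less than [delta] in total;
   [K.+1] keeps the denominator positive for every [K]. *)
pose e := delta / (expR 1 * K.+1%:R).
have e1K : 0 < expR 1 * K.+1%:R :> R by rewrite mulr_gt0 ?expR_gt0.
have e0 : 0 < e by rewrite divr_gt0.
have c0 : 0 < expR 1 * a by rewrite mulr_gt0 ?expR_gt0.
have c0' : 0 < expR 1 * e by rewrite mulr_gt0 ?expR_gt0.
have mA : measurable [set t | wgeom_mean w X t <= a].
  rewrite (_ : [set _ | _] = wgeom_mean w X @^-1` `]-oo, a]).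
    exact: measurable_funPTI.
  by apply/seteqP; split => x /=; rewrite in_itv.
have mg c k : measurable_fun setT (log_test c e \o X k).
  exact: (measurableT_comp (measurable_log_test c e0)).
have g0 c k t : 0 <= log_test c e (X k t) by exact: log_test_ge0.
have mf1 k : measurable_fun setT
    (fun t => (wpos k t * log_test (expR 1 * a) e (X k t))%:E).
  by apply/measurable_EFinP; apply: measurable_funM => //; exact: mg.
have mf2 k : measurable_fun setT
    (fun t => (log_test (expR 1 * e) e (X k t))%:E).
  by apply/measurable_EFinP; exact: mg.
rewrite -[X in P X]setIT -integral_indic//.
(* Markov-type step: the indicator of the event is almost surely at most the sum of the weighted
   tests and the tests for small values. *)
apply: (@le_trans _ _ (\int[P]_t
  (\sum_(k < K) (wpos k t * log_test (expR 1 * a) e (X k t))%:E +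
   \sum_(k < K) (log_test (expR 1 * e) e (X k t))%:E))%E).
  apply: ae_ge0_le_integral => //.
  - by apply/measurable_EFinP; exact: measurable_indic.
  - by move=> t _; rewrite adde_ge0// sume_ge0// => k _; rewrite lee_fin ?mulr_ge0.
  - by apply: emeasurable_funD; exact: emeasurable_sum.
  - apply: filterS2 ae_wposE w_sum1 => t wE w1 _ /=.
    rewrite !sumEFin -EFinD lee_fin indicE.
    case: (boolP (t \in _)) => [/set_mem Wa|_].
      exact: wgeom_mean_le_log_test.
    by rewrite addr_ge0// sumr_ge0// => k _; rewrite mulr_ge0.
rewrite ge0_integralD//; last 4 first.
- by move=> t _; rewrite sume_ge0// => k _; rewrite lee_fin ?mulr_ge0.
- exact: emeasurable_sum.
- by move=> t _; rewrite sume_ge0// => k _; rewrite lee_fin.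
- exact: emeasurable_sum.
apply: leeD.
  rewrite ge0_integral_sum//; last first.
    by move=> k t _; rewrite lee_fin mulr_ge0.
  (* The factor 1 is expanded as the sum of the expected weights, to compare term by term. *)
  rewrite -[leRHS]mul1e -sum_expectation_weights ge0_sume_distrl; last first.
    by move=> k _; exact: expectation_ge0.
  apply: lee_sum => k _; apply: le_trans (expectation_weighted_log_test k c0 e0).
  by rewrite unlock.
rewrite ge0_integral_sum//; last by move=> k t _; rewrite lee_fin.
apply: (@le_trans _ _ (\sum_(k < K) (expR 1 * e)%:E)%E).
  apply: lee_sum => k _.
  apply: le_trans (pstar_expectation_log_test (@X_pstar k) c0' e0).
  by rewrite unlock.
rewrite sumEFin lee_fin sumr_const card_ord -mulr_natr.
rewrite /e -[leRHS](divfK (lt0r_neq0 e1K)).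
have -> : expR 1 * (delta / (expR 1 * K.+1%:R)) * K%:R =
  delta / (expR 1 * K.+1%:R) * (expR 1 * K%:R) by ring.
by rewrite ler_wpM2l ?(ltW e0)// ler_wpM2l ?expR_ge0// ler_nat leqnSn.
Qed.

End geometric_mean.

Theorem theorem5p2 (R : realType) (d : measure_display) (T : measurableType d)
    (P : probability T R) (K : nat) (X w : 'I_K -> {RV P >-> R})
    (X_pstar : forall k, pstar_variable P (X k))
    (w_ge0 : forall k, {ae P, forall t, 0 <= w k t})
    (w_sum1 : {ae P, forall t, \sum_(k < K) w k t = 1})
    (wX_indep : independent_RV P (joint w) (joint X)) :
  p_variable P (cst (expR 1) \* wgeom_mean w X) /\
  (forall a : R, 0 < a < 1 ->
     (P [set t | (wgeom_mean w X t <= a)%R] <= (expR 1 * a)%:E)%E).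
Proof.
split; last first.
  by move=> a /andP[a0 _]; exact: wgeom_mean_prob_le.
apply: p_variable_cdf => a /andP[a0 a1].
(* The event that [expR 1] times the mean is at most [a] is the event that the mean is at most
   [a / expR 1]. *)
have ae0 : 0 < a / expR 1 by rewrite divr_gt0 ?expR_gt0.
have := wgeom_mean_prob_le X_pstar w_ge0 w_sum1 wX_indep ae0.
rewrite [expR 1 * _]mulrC divfK ?gt_eqF ?expR_gt0//.
apply: le_trans; rewrite le_eqVlt; apply/orP; left; apply/eqP.
congr (P _); apply/seteqP; split => t /=; by rewrite ler_pdivlMr ?expR_gt0// mulrC.
Qed.
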